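(* Let $(X,d)$ be a compact metric space, let $G=\{f_0,\ldots,f_{m-1}\}$ be continuous maps of $X$ to itself generating a free semigroup action, let $\varphi\in C(X,\mathbb{R})$ and let $c\in\mathbb{R}$ be a constant. Let $F:\Sigma_m\times X\to\Sigma_m\times X$ be the skew-product $F(\omega,x)=(\sigma_m\omega,f_{\omega_0}(x))$ and let $g:\Sigma_m\times X\to\mathbb{R}$, $g(\omega,x)=c+\varphi(x)$, where $\omega=(\ldots,\omega_{-1},\omega_0,\omega_1,\ldots)$. Then for any set $Z\subset X$, $$\overline{CP}_{\Sigma_m\times Z}(F,g)=\log m+\overline{CP}_Z(G,\varphi)+c.$$
   Context: **Symbolic space.** $\Sigma_m$ is the set of two-sided infinite sequences $\omega=(\ldots,\omega_{-1},\omega_0,\omega_1,\ldots)$ in the symbols $0,\ldots,m-1$, with metric $d'(\omega,\omega')=2^{-k}$, $k=\inf\{|n|:\omega_n\ne\omega_n'\}$, and $\sigma_m$ is the shift $(\sigma_m\omega)_k=\omega_{k+1}$. The metric on $\Sigma_m\times X$ is $D((\omega,x),(\omega',x'))=\max(d'(\omega,\omega'),d(x,x'))$. **Upper capacity topological pressure.** Let $Y$ be a compact metric space, $H=\{h_0,\ldots,h_{p-1}\}$ ($p\ge1$) continuous maps $Y\to Y$, and $\Psi=\{\psi_0,\ldots,\psi_{p-1}\}\subset C(Y,\mathbb{R})$. For a word $w=i_1\cdots i_n$ in the symbols $0,\ldots,p-1$, of length $|w|=n$, let $$S_w\Psi(y)=\psi_{i_1}(y)+\psi_{i_2}(h_{i_1}(y))+\cdots+\psi_{i_n}(h_{i_{n-1}}\circ\cdots\circ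 h_{i_1}(y)).$$ Let $\mathcal{U}$ be a finite open cover of $Y$. For a string $\mathbf{U}=(U_0,\ldots,U_n)\in\mathcal{U}^{n+1}$ let $Y_w(\mathbf{U})=\{y: y\in U_0,\ h_{i_j}\circ\cdots\circ h_{i_1}(y)\in U_j,\ j=1,\ldots,n\}$. For $A\subset Y$ and $|w|=N$ put $$\Lambda_w(A,\Psi,\mathcal{U},N)=\inf_{\mathcal{G}_w}\sum_{\mathbf{U}\in\mathcal{G}_w}\exp\Big(\sup_{y\in Y_w(\mathbf{U})}S_w\Psi(y)\Big),$$ the infimum being over finite or countable families $\mathcal{G}_w\subset\mathcal{U}^{N+1}$ with $\bigcup_{\mathbf{U}\in\mathcal{G}_w}Y_w(\mathbf{U})\supset A$ (with $\sup\emptyset=-\infty$, $\exp(-\infty)=0$). Put $\Lambda(A,\Psi,\mathcal{U},N)=\frac{1}{p^N}\sum_{|w|=N}\Lambda_w(A,\Psi,\mathcal{U},N)$, $R(A,\alpha,\Psi,\mathcal{U},N)=\Lambda(A,\Psi,\mathcal{U},N)e^{-\alpha(N+1)}$, $\overline{r}(A,\alpha,\Psi,\mathcal{U})=\limsup_{N\to\infty}R(A,\alpha,\Psi,\mathcal{U},N)$, $$\overline{CP}_A(H,\Psi,\mathcal{U})=\inf\{\alpha:\overline{r}(A,\alpha,\Psi,\mathcal{U})=0\}=\sup\{\alpha:\overline{r}(A,\alpha,\Psi,\mathcal{U})=\infty\},$$ and $\overline{CP}_A(H,\Psi)=\lim_{|\mathcal{U}|\to0}\overline{CP}_A(H,\Psi,\mathcal{U})$,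 the limit (which exists) being over finite open covers with maximal diameter $|\mathcal{U}|$ tending to $0$. In the claim, $\overline{CP}_Z(G,\varphi)$ is this quantity with $Y=X$, $H=G$, $p=m$ and $\psi_0=\cdots=\psi_{m-1}=\varphi$; $\overline{CP}_{\Sigma_m\times Z}(F,g)$ is this quantity with $Y=\Sigma_m\times X$, $p=1$, $H=\{F\}$ and $\Psi=\{g\}$ (Pesin's upper capacity topological pressure of a single map). *)

(* Defs.v *)
From HB Require Import structures.
From mathcomp Require Import all_boot all_order all_algebra.
From mathcomp Require Import all_classical all_reals all_analysis.

Set Implicit Arguments.
Unset Strict Implicit.
Unset Printing Implicit Defensive.

Import Order.TTheory GRing.Theory Num.Theory.
Import numFieldNormedType.Exports.

Local Open Scope classical_set_scope.
Local Open Scope ring_scope.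

(* A product of metric spaces carries the max metric; MathComp-Analysis only
   provides the corresponding pseudometric structure. *)
Section prod_metric.
Context {R : realType} (U V : metricType R).

Definition prod_mdist (a b : U * V) : R :=
  Num.max (mdist a.1 b.1) (mdist a.2 b.2).

Let prod_mdist_ge0 a b : 0 <= prod_mdist a b.
Proof. by rewrite /prod_mdist le_max mdist_ge0. Qed.

Let prod_mdist_positivity a b : prod_mdist a b = 0 -> a = b.
Proof.
case: a b => [a1 a2] [b1 b2]; rewrite /prod_mdist /= => ab0.
have : Num.max (mdist a1 b1) (mdist a2 b2) <= 0 by rewrite ab0.
rewrite ge_max => /andP[d1 d2]; congr pair; apply: mdist_positivity;
  by apply/eqP; rewrite eq_le mdist_ge0 ?d1 ?d2.
Qed.

Let ballE_prod_mdist a e : ball a e = [set b | prod_mdist a b < e].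
Proof.
rewrite /ball /= /prod_ball !ballEmdist /prod_mdist.
apply/seteqP; split => -[b1 b2] /=.
  by case=> /= h1 h2; rewrite gt_max h1 h2.
by rewrite gt_max => /andP[].
Qed.

HB.instance Definition _ := PseudoMetric_isMetric.Build R (U * V)%type
  prod_mdist_ge0 prod_mdist_positivity ballE_prod_mdist.

End prod_metric.

(* Sigma_m; the parameter R is only the field in which distances are valued. *)
Definition symbolic_space (R : realType) (m : nat) : Type := int -> 'I_m.

HB.instance Definition _ (R : realType) (m : nat) :=
  Choice.copy (symbolic_space R m) (int -> 'I_m).

Section symbolic_metric.
Context {R : realType} {m : nat}.
Implicit Types a b : symbolic_space R m.

Definition disagree a b : pred nat :=
  fun k => `[< exists n : int, absz n = k /\ a n <> b n >].

Definition symb_dist a b : R :=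
  if pselect (exists k, disagree a b k) is left h
  then 2^-1 ^+ ex_minn h else 0.

Let symb_distxx a : symb_dist a a = 0.
Proof.
rewrite /symb_dist; case: pselect => // h; exfalso.
by case: h => k /asboolP[n [_]]; apply.
Qed.

Let symb_dist_positivity a b : symb_dist a b = 0 -> a = b.
Proof.
rewrite /symb_dist; case: pselect => [h /eqP|h _].
  by rewrite expf_eq0 invr_eq0 pnatr_eq0 andbF.
apply/funext => n; apply: contrapT => ab; apply: h.
by exists (absz n); apply/asboolP; exists n.
Qed.

Let disagreeC a b : disagree a b = disagree b a.
Proof.
apply/funext => k; rewrite /disagree; apply/asbool_equiv_eq.
by split=> -[n [nk ab]]; exists n; split=> // /esym.
Qed.

Let symb_distC a b : symb_dist a b = symb_dist b a.
Proof. by rewrite /symb_dist disagreeC. Qed.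

Let symb_dist_ge0 a b : 0 <= symb_dist a b.
Proof. by rewrite /symb_dist; case: pselect => // h; rewrite exprn_ge0. Qed.

Let symb_dist_ge a b k : disagree a b k -> 2^-1 ^+ k <= symb_dist a b.
Proof.
move=> abk; rewrite /symb_dist; case: pselect => [h|nab]; last first.
  by exfalso; apply: nab; exists k.
case: ex_minnP => j _ /(_ _ abk) jk.
by rewrite ler_wiXn2l// invf_le1// ler1n.
Qed.

Let symb_dist_triangle b a c :
  symb_dist a c <= symb_dist a b + symb_dist b c.
Proof.
rewrite {1}/symb_dist; case: pselect => [h|_]; last by rewrite addr_ge0.
case: ex_minnP => k /asboolP[n [nk ac]] _.
have [ab|ab] := pselect (a n = b n).
- rewrite -[leLHS]add0r lerD// symb_dist_ge//; apply/asboolP.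
  by exists n; split => //; rewrite -ab.
- by rewrite -[leLHS]addr0 lerD// symb_dist_ge//; apply/asboolP; exists n.
Qed.

HB.instance Definition _ := @isMetric.Build R (symbolic_space R m)
  symb_dist symb_distxx symb_dist_positivity symb_distC symb_dist_triangle.

Definition shift (a : symbolic_space R m) : symbolic_space R m :=
  fun k => a (k + 1).

Definition skew_product (X : Type) (f : 'I_m -> X -> X)
    (z : symbolic_space R m * X) : symbolic_space R m * X :=
  (shift z.1, f (z.1 0) z.2).

End symbolic_metric.

Section upper_capacity_pressure.
Context {R : realType} {Y : metricType R} {p : nat}.
Variables (h : 'I_p -> Y -> Y) (psi : 'I_p -> Y -> R).

(* With w = i_1 ... i_n and j <= n, the point h_{i_j} (... (h_{i_1} y)). *)
Definition word_orbit (w : seq 'I_p) (j : nat) (y : Y) : Y :=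
  foldl (fun z i => h i z) y (take j w).

(* Letters are numbered from 0 here: tnth w j is i_{j+1}. *)
Definition word_sum (n : nat) (w : n.-tuple 'I_p) (y : Y) : R :=
  \sum_(j < n) psi (tnth w j) (word_orbit w j y).

Definition string_set (n : nat) (w : n.-tuple 'I_p)
    (u : n.+1.-tuple (set Y)) : set Y :=
  [set y | forall j : 'I_n.+1, tnth u j (word_orbit w j y)].

Definition finite_open_cover (U : set (set Y)) : Prop :=
  [/\ finite_set U, (forall A, U A -> open A)
    & \bigcup_(A in U) A = [set: Y]].

Definition mesh (U : set (set Y)) : \bar R :=
  ereal_sup [set d | exists A x y, [/\ U A, A x, A y & d = (mdist x y)%:E]].

Definition string_cover (A : set Y) (U : set (set Y)) (n : nat)
    (w : n.-tuple 'I_p) (G : set (n.+1.-tuple (set Y))) : Prop :=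
  [/\ countable G, (forall u, G u -> forall j, U (tnth u j))
    & A `<=` \bigcup_(u in G) string_set w u].

(* expeR (-oo) = 0 and the supremum of the empty set is -oo. *)
Definition Lambda_word (A : set Y) (U : set (set Y)) (n : nat)
    (w : n.-tuple 'I_p) : \bar R :=
  ereal_inf [set \esum_(u in G)
      expeR (ereal_sup [set (word_sum w y)%:E | y in string_set w u])
    | G in string_cover A U w].

Definition Lambda (A : set Y) (U : set (set Y)) (n : nat) : \bar R :=
  (((p%:R ^+ n)^-1)%:E * \sum_(w : n.-tuple 'I_p) Lambda_word A U w)%E.

Definition Rsum (A : set Y) (alpha : R) (U : set (set Y)) (n : nat) : \bar R :=
  (Lambda A U n * (expR (- (alpha * n.+1%:R)))%:E)%E.

Definition rsup (A : set Y) (alpha : R) (U : set (set Y)) : \bar R :=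
  limn_esup (Rsum A alpha U).

Definition CP_cover (A : set Y) (U : set (set Y)) : \bar R :=
  ereal_inf [set alpha%:E | alpha in [set alpha : R | rsup A alpha U = 0%E]].

Definition fine_covers : set_system (set (set Y)) :=
  filter_from [set e : R | 0 < e]
    (fun e => [set U | finite_open_cover U /\ (mesh U < e%:E)%E]).

Definition CP (A : set Y) : \bar R := lim (CP_cover A U @[U --> fine_covers]).

End upper_capacity_pressure.

(* Main.v *)
Require Import Defs.
From mathcomp Require Import all_boot all_order all_algebra.
From mathcomp Require Import all_classical all_reals all_analysis.
From mathcomp Require Import ring lra zify.
Import numFieldNormedType.Exports.
Import Order.TTheory GRing.Theory Num.Theory.
Local Open Scope classical_set_scope.
Local Open Scope ring_scope.

(** The skew product is compared with the semigroup on covers of Sigma_m * X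
    made of products of a cylinder over the window [-k, k] with an element of a
    cover U of X.  A string of n + 1 such products is nonempty only if its
    cylinders are the windows of one sequence moved along its orbit, and then it
    is the product of one cylinder over [-k, n + k] with the string set of U
    along the word w read by that sequence on [0, n).  The string sums of the
    skew product are therefore c n plus those of phi along w, and an optimal
    family for the skew product is a free choice of an optimal family for each
    of the m ^ (n + 2k + 1) cylinders.  As each w has m ^ (2k + 1) extensions,
      Lambda (skew product) n = m^(2k+1) e^(c n) sum over w of Lambda_word w
                              = m^(2k+1) e^((ln m + c) n) Lambda (semigroup) n.
    The factor m^(2k+1) does not depend on n, so it disappears in the growth
    rate: the capacities of the two covers differ by exactly ln m + c
    ([CP_cover_skew]).

    The capacities are limits over arbitrary fine covers, whereas product covers
    form a special family, so the existence of both limits is needed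
    ([CP_cvg]).  If V refines U and the potentials oscillate by at most g on the
    elements of U, replacing the members of a V-string by larger members of U
    costs a factor e^g per letter, whence CP(U) <= CP(V) + g.  By compactness
    every sufficiently fine V refines U, and g is small when U is fine: up to
    small errors the capacity increases along the filter of fine covers, which
    forces convergence in the extended reals, possibly to an infinite value.  On
    the product space this uses that Sigma_m is compact ([symbolic_compact]).
    Evaluating both limits along one sequence of product covers concludes. *)

(** * Unordered sums and infima of extended reals *)

Lemma esum_subset {R : realType} {T : choiceType} (P Q : set T)
    (a : T -> \bar R) : (forall j, 0 <= a j)%E -> P `<=` Q ->
  (\esum_(j in P) a j <= \esum_(i in Q) a i)%E.
Proof.
move=> a0 PQ; apply: ereal_sup_le => _ [X [finX XP] <-].
by exists X => //; split=> //; exact: subset_trans PQ.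
Qed.

(** Pulling back along a section of e selects one preimage for each term, and
    the discarded preimages carry nonnegative terms.  It bounds the cost of a
    family of strings through any, possibly redundant, parametrization. *)
Lemma esum_image_le {R : realType} {T T' : choiceType} (P : set T)
    (e : T -> T') (a : T' -> \bar R) : (forall j, 0 <= a j)%E ->
  (\esum_(j in e @` P) a j <= \esum_(i in P) a (e i))%E.
Proof.
move=> a0; have [->|/set0P[i0 _]] := eqVneq P set0.
  by rewrite image_set0 !esum_set0.
have [s sP] : {s : T' -> T & forall j, (e @` P) j -> P (s j) /\ e (s j) = j}.
  apply: (@boolp.choice _ _ (fun j i => (e @` P) j -> P i /\ e i = j)) => j.
  by have [[i Pi <-]|nPj] := pselect ((e @` P) j); [exists i|exists i0].
have -> : (\esum_(j in e @` P) a j = \esum_(j in e @` P) a (e (s j)))%E.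
  by apply: eq_esum => j /sP[_ ->].
rewrite -(@esum_image _ _ _ (e @` P) s (a \o e)).
  by apply: esum_subset => [i|_ [j /sP[? _] <-]//]; exact: a0.
move=> j1 j2; rewrite !inE => /sP[_ {2}<-] /sP[_ {2}<-].
by move=> ->.
Qed.

Lemma esum_le_scale {R : realType} {T : choiceType} (P : set T)
    (a b : T -> \bar R) (c : R) : 0 <= c -> (forall i, 0 <= b i)%E ->
    (forall i, P i -> a i <= c%:E * b i)%E ->
  (\esum_(i in P) a i <= c%:E * \esum_(i in P) b i)%E.
Proof.
move=> c0 b0 ab; apply: le_trans; first exact: le_esum ab.
apply: ge_ereal_sup => _ [X [finX XP] <-].
rewrite -ge0_mule_fsumr// lee_wpmul2l//.
by apply: ereal_sup_ubound; exists X.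
Qed.

Lemma esum_fintype {R : realType} {T : finType} (a : T -> \bar R) :
  (forall i, 0 <= a i)%E -> (\esum_(i in [set: T]) a i = \sum_i a i)%E.
Proof.
move=> a0; rewrite esum_fset//; last exact: finite_finset.
have <- : [set` index_enum T] = [set: T].
  by apply/seteqP; split => // x _ /=; rewrite mem_index_enum.
by rewrite -fsbig_seq ?index_enum_uniq.
Qed.

(** Infima over independent choices: near-optimal elements can be selected for
    every index at once. *)
Lemma le_sum_ereal_inf {R : realType} {I : finType} (x : \bar R)
    (S : I -> set (\bar R)) :
    (forall i y, S i y -> 0 <= y)%E ->
    (forall s, (forall i, S i (s i)) -> x <= \sum_i s i)%E ->
  (x <= \sum_i ereal_inf (S i))%E.
Proof.
move=> S0 xS.
have inf0 i : (0 <= ereal_inf (S i))%E by apply: le_ereal_inf_tmp => y /S0.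
have [[i iy]|infy] := pselect (exists i, ereal_inf (S i) = +oo%E).
  rewrite (bigD1 i)//= iy addye ?leey// gt_eqF//.
  by apply: lt_le_trans (ltNyr 0) _; apply: sume_ge0 => j _.
have fin i : ereal_inf (S i) \is a fin_num.
  rewrite ge0_fin_numE// ltey; apply/eqP => iy; apply: infy; by exists i.
apply/lee_addgt0Pr => e e0.
pose d := e / #|I|.+1%:R.
have d0 : 0 < d by rewrite divr_gt0.
have sP i : exists y, S i y /\ (y <= ereal_inf (S i) + d%:E)%E.
  by have [y Sy /ltW] := lb_ereal_inf_adherent d0 (fin i); exists y.
have [s {}sP] := boolp.choice sP.
apply: le_trans (xS s _) _; first by move=> i; exact: (sP i).1.
apply: (@le_trans _ _ (\sum_i (ereal_inf (S i) + d%:E))%E).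
  by apply: lee_sum => i _; exact: (sP i).2.
rewrite big_split/= leeD2l// sumEFin lee_fin sumr_const.
rewrite -[d *+ _]mulr_natr /d mulrAC ler_pdivrMr//.
by rewrite ler_wpM2l ?ler_nat// ltW.
Qed.

(** * Comparing exponential growth rates *)

(** The cost of one string in [Lambda_word], with S the word sum and A the
    string set. *)
Definition sup_exp {R : realType} {T : Type} (S : T -> R) (A : set T) :
    \bar R :=
  expeR (ereal_sup [set (S y)%:E | y in A]).

Lemma sup_exp_ge0 {R : realType} {T : Type} (S : T -> R) (A : set T) :
  (0 <= sup_exp S A)%E.
Proof. exact: expeR_ge0. Qed.

(** When A is empty the left side is exp (-oo) = 0, so the inequality remains
    true there. *)
Lemma le_sup_exp {R : realType} {T T' : Type} (S : T -> R) (A : set T)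
    (S' : T' -> R) (A' : set T') (d : R) :
  (forall y, A y -> exists2 y', A' y' & S y <= S' y' + d) ->
  (sup_exp S A <= (expR d)%:E * sup_exp S' A')%E.
Proof.
move=> SS'; rewrite -[(expR d)%:E]/(expeR d%:E) -expeRD lee_expeR addeC.
apply: ge_ereal_sup => _ [y /SS'[y' Ay' Sy] <-].
apply: (@le_trans _ _ (S' y' + d)%:E); first by rewrite lee_fin.
by rewrite EFinD leeD2r//; apply: ereal_sup_ubound; exists y'.
Qed.

Lemma limn_esup0_le {R : realType} (u v : (\bar R)^nat) (C : R) :
    (forall n, 0 <= u n)%E -> (forall n, 0 <= v n)%E ->
    (forall n, u n <= C%:E * v n)%E ->
  limn_esup v = 0%E -> limn_esup u = 0%E.
Proof.
move=> u0 v0 uCv lv0.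
have v_cvg : v @ \oo --> 0%E by apply: limn_esup_le_cvg => //; rewrite lv0.
have Cv_cvg : (C%:E * v n)%E @[n --> \oo] --> 0%E.
  by rewrite -(mule0 C%:E); exact: cvgeZl.
suff /cvg_limn_einf_sup[_] : u @ \oo --> 0%E by [].
apply: squeeze_cvge (cvg_cst 0%E) Cv_cvg.
by apply: nearW => n; rewrite u0 uCv.
Qed.

Section capacity.
Context {R : realType} {Y : metricType R} {p : nat}.
Variables (h : 'I_p -> Y -> Y) (psi : 'I_p -> Y -> R).

Lemma Lambda_word_ge0 A U n (w : n.-tuple 'I_p) :
  (0 <= Lambda_word h psi A U w)%E.
Proof.
apply: le_ereal_inf_tmp => _ [G _ <-]; apply: esum_ge0 => u _.
exact: expeR_ge0.
Qed.

Lemma Lambda_ge0 A U n : (0 <= Lambda h psi A U n)%E.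
Proof.
apply: mule_ge0; first by rewrite lee_fin invr_ge0 exprn_ge0.
by apply: sume_ge0 => w _; exact: Lambda_word_ge0.
Qed.

Lemma Rsum_ge0 A a U n : (0 <= Rsum h psi A a U n)%E.
Proof. by rewrite mule_ge0 ?Lambda_ge0// lee_fin expR_ge0. Qed.

End capacity.

(** The single comparison principle of the proof: a constant factor C does not
    change an exponential growth rate and a factor e^(d n) shifts it by d. *)
Lemma CP_cover_le {R : realType} {Y Y' : metricType R} {p p' : nat}
    (h : 'I_p -> Y -> Y) (psi : 'I_p -> Y -> R)
    (h' : 'I_p' -> Y' -> Y') (psi' : 'I_p' -> Y' -> R)
    (A : set Y) (U : set (set Y)) (A' : set Y') (U' : set (set Y')) (C d : R) :
    0 <= C ->
    (forall n, Lambda h' psi' A' U' n <=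
       (C * expR (d * n%:R))%:E * Lambda h psi A U n)%E ->
  (CP_cover h' psi' A' U' <= CP_cover h psi A U + d%:E)%E.
Proof.
move=> C0 LL'; rewrite -leeBlDr//; apply: le_ereal_inf_tmp => _ [a /= ra <-].
rewrite EFinN leeBlDr// -EFinD; apply: ereal_inf_lbound; exists (a + d) => //=.
apply: (@limn_esup0_le _ _ (Rsum h psi A a U) (C * expR (- d))) ra => n.
- exact: Rsum_ge0.
- exact: Rsum_ge0.
(* [Rsum] normalizes by n + 1 while the factor e^(d n) only runs over n
   letters; the missing e^(-d) goes into the constant. *)
have -> : ((C * expR (- d))%:E * Rsum h psi A a U n =
    (C * expR (d * n%:R))%:E * Lambda h psi A U n *
      (expR (- ((a + d) * n.+1%:R)))%:E)%E.
  rewrite /Rsum [in RHS]muleAC -[in RHS]EFinM [in LHS]muleA [in LHS]muleAC.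
  rewrite -[in LHS]EFinM -!mulrA -!expRD.
  by congr ((_ * expR _)%:E * _)%E; rewrite mulrS; ring.
by rewrite /Rsum lee_wpmul2r// lee_fin expR_ge0.
Qed.

(** * Pressure along fine covers *)

(** Such a function lies eventually above any level below its lower limit L, and
    by hypothesis eventually below L + e for every e > 0. *)
Lemma almost_nondecreasing_is_cvg {R : realType} {T : Type}
    {F : set_system T} {FF : ProperFilter F} (v : T -> \bar R) :
    (forall e : R, 0 < e ->
      \forall s \near F, \forall t \near F, (v s <= v t + e%:E)%E) ->
  exists l : \bar R, v @ F --> l.
Proof.
move=> v_incr; pose L := ereal_sup [set l | \forall t \near F, (l <= v t)%E].
have v_ge l : (l < L)%E -> \forall t \near F, (l <= v t)%E.
  move=> /ereal_sup_gt[y /= Fy ly]; apply: filterS Fy => t.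
  exact: le_trans (ltW ly).
have v_le (e : R) : 0 < e -> \forall s \near F, (v s <= L + e%:E)%E.
  move=> e0; apply: filterS (v_incr e e0) => s Fs.
  rewrite -leeBlDr//; apply: ereal_sup_ubound => /=.
  by apply: filterS Fs => t; rewrite EFinN leeBlDr.
exists L; case: L v_ge v_le => [r| |] v_ge v_le.
- apply/fine_cvgP; split.
    near=> t; rewrite fin_numElt; apply/andP; split.
      apply: (@lt_le_trans _ _ (r - 1)%:E); first exact: ltNyr.
      by near: t; apply: v_ge; rewrite lte_fin; lra.
    apply: (@le_lt_trans _ _ (r + 1)%:E); last exact: ltry.
    by near: t; rewrite EFinD; apply: v_le.
  apply/cvgrPdist_le => e e0; near=> t.
  rewrite /=; have : ((r - e)%:E <= v t <= (r + e)%:E)%E.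
    apply/andP; split; near: t.
      by apply: v_ge; rewrite lte_fin; lra.
    by rewrite EFinD; apply: v_le.
  case: (v t) => [a| |]; [|by rewrite leye_eq andbF|by rewrite leeNy_eq].
  by rewrite !lee_fin/= ler_distlC.
- by apply/(@cvgeyPge _ _ F _ v) => a; apply: v_ge; exact: ltry.
- apply/cvgeNyPle => a; apply: filterS (v_le 1 ltr01) => t.
  by rewrite addNye leeNy_eq => /eqP ->; exact: leNye.
Unshelve. all: by end_near. Qed.

(** Replacing each member of a V-string by a member of U that contains it
    enlarges the string set; along the orbit segment, two points of the enlarged
    set visit the same members of U, so their word sums differ by at most g n.
    Refinement is required of nonempty members only, because strings with an
    empty string set can be discarded; this keeps the lemma applicable when Y, and
    hence possibly U, is empty. *)
Lemma Lambda_word_refine {R : realType} {Y : metricType R} {p : nat}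
    (h : 'I_p -> Y -> Y) (psi : 'I_p -> Y -> R) (A : set Y)
    (U V : set (set Y)) (g : R) (n : nat) (w : n.-tuple 'I_p) :
    (forall B, V B -> B !=set0 -> exists2 C, U C & B `<=` C) ->
    (forall i C x y, U C -> C x -> C y -> psi i x <= psi i y + g) ->
  (Lambda_word h psi A U w <= (expR (g * n%:R))%:E * Lambda_word h psi A V w)%E.
Proof.
move=> VU osc; rewrite -lee_pdivrMl ?expR_gt0//.
apply: le_ereal_inf_tmp => _ [G [cG GV AG] <-].
rewrite lee_pdivrMl ?expR_gt0//.
have [r rP] : {r : set Y -> set Y &
    forall B, V B -> B !=set0 -> U (r B) /\ B `<=` r B}.
  apply: (@boolp.choice _ _ (fun B C => V B -> B !=set0 -> U C /\ B `<=` C)).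
  move=> B; have [[VB B0]|nVB] := pselect (V B /\ B !=set0).
    by have [C UC BC] := VU _ VB B0; exists C.
  by exists B => VB B0; case: nVB.
(* Strings with an empty string set are dropped: [le_sup_exp] compares with a
   point of the smaller set. *)
pose G' := [set u | G u /\ string_set h w u !=set0].
have G'P u j : G' u -> U (r (tnth u j)) /\ tnth u j `<=` r (tnth u j).
  by move=> [Gu [y uy]]; apply: rP; [exact: GV|exists (word_orbit h w j y)].
pose E := [set map_tuple r u | u in G'].
have EU : string_cover h A U w E.
  split.
  - by apply: card_le_trans (card_image_le _ _) _; apply: sub_countable cG;
      apply: subset_card_le => u [].
  - by move=> _ [u G'u <-] j; rewrite tnth_map; exact: (G'P _ _ G'u).1.
  - move=> y /AG[u Gu uy]; exists (map_tuple r u).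
      by exists u => //; split=> //; exists y.
    move=> j; rewrite tnth_map; apply: (G'P _ _ _).2 => //.
    by split=> //; exists y.
apply: le_trans (ereal_inf_lbound _) _; first by exists E; [exact: EU|].
apply: le_trans (esum_image_le _ _ _ _) _; first by move=> ?; exact: expeR_ge0.
pose wt u := sup_exp (word_sum h psi w) (string_set h w u).
apply: (@le_trans _ _ ((expR (g * n%:R))%:E * \esum_(u in G') wt u)%E);
    last first.
  rewrite lee_wpmul2l ?lee_fin ?expR_ge0//; apply: esum_subset => [u|u []//].
  exact: sup_exp_ge0.
apply: esum_le_scale => [|u|u G'u]; [exact: expR_ge0|exact: sup_exp_ge0|].
have [_ [y' uy']] := G'u; apply: le_sup_exp => y uy; exists y' => //.
rewrite /word_sum mulr_natr -[n in _ *+ n]card_ord -sumr_const -big_split/=.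
apply: ler_sum => j _.
have [Urj rj] := G'P u (widen_ord (leqnSn n) j) G'u.
apply: (osc _ _ _ _ Urj); last exact/rj/uy'.
by have := uy (widen_ord (leqnSn n) j); rewrite tnth_map.
Qed.

(** Lebesgue number lemma in abstract form: it gives a Lebesgue number when Q B
    says that B is contained in a member of an open cover, and uniform continuity
    when Q B says that a continuous function oscillates by at most g on B. *)
Lemma uniform_small_balls {R : realType} {Y : metricType R}
    (Q : set Y -> Prop) :
    compact [set: Y] ->
    (forall B C, Q C -> B `<=` C -> Q B) ->
    (forall x, exists2 e : R, 0 < e & Q (ball x e)) ->
  exists2 e : R, 0 < e & forall x, Q (ball x e).
Proof.
move=> cY Qsub Qloc.
have Qnear : \forall e \near (0:R)^'+, [set: Y] `<=` (fun x => Q (ball x e)).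
  move/compact_near_coveringP : cY; apply => x _.
  have [e e0 Qe] := Qloc x.
  exists (ball x (e / 2), [set d | 0 < d < e / 2]) => /=.
    split; first by apply: nbhsx_ballx; rewrite divr_gt0.
    near=> d; apply/andP; split => //=; near: d.
    by apply: nbhs_right_lt; rewrite divr_gt0.
  move=> [y d] /= [xy /andP[d0 de]]; apply: Qsub Qe _ => z yz.
  rewrite (splitr e); apply: ball_triangle xy _.
  by apply: le_ball yz; exact: ltW.
near (0:R)^'+ => e.
have e0 : 0 < e by [].
by exists e => // x; apply: (near Qnear e).
Unshelve. all: by end_near. Qed.

Lemma mesh_lt_ball {R : realType} {Y : metricType R} (V : set (set Y))
    (e : R) :
  (mesh V < e%:E)%E -> forall B x y, V B -> B x -> B y -> ball x e y.
Proof.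
move=> Ve B x y VB Bx By; rewrite ballEmdist/= -lte_fin; apply: le_lt_trans Ve.
by apply: ereal_sup_ubound; exists B, x, y.
Qed.

Lemma mesh_le {R : realType} {Y : metricType R} (V : set (set Y)) (e : R) :
  (forall B x y, V B -> B x -> B y -> mdist x y <= e) -> (mesh V <= e%:E)%E.
Proof.
move=> Ve; apply: ge_ereal_sup => _ [B [x [y [VB Bx By ->]]]].
by rewrite lee_fin; exact: (Ve B).
Qed.

Lemma fine_covers_small {R : realType} {Y : metricType R} (Q : set Y -> Prop) :
    compact [set: Y] ->
    (forall B C, Q C -> B `<=` C -> Q B) ->
    (forall x, exists2 e : R, 0 < e & Q (ball x e)) ->
  \forall V \near fine_covers, forall B, V B -> B !=set0 -> Q B.
Proof.
move=> cY Qsub /(uniform_small_balls _ cY Qsub)[e e0 Qe].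
exists e => // V [_ Ve] B VB [x Bx]; apply: Qsub (Qe x) _ => y By.
exact: (mesh_lt_ball _ _ Ve _ _ _ VB Bx By).
Qed.

(** Compactness is applied to the filter of finite sets of centres directed by
    inclusion, which avoids choosing a base point in a possibly empty Y. *)
Lemma compact_totally_bounded {R : realType} {Y : metricType R} (e : R) :
  compact [set: Y] -> 0 < e ->
  exists2 D : set Y, finite_set D & forall x, exists2 c, D c & ball c e x.
Proof.
move=> cY e0.
pose F : set_system (set Y) :=
  filter_from finite_set (fun D => [set E | finite_set E /\ D `<=` E]).
have FF : ProperFilter F.
  apply: filter_from_proper => [|D fD]; last by exists D; split.
  apply: filter_from_filter => [|D E fD fE]; first by exists set0.
  exists (D `|` E); first by rewrite finite_setU.
  by move=> G [fG DEG]; split; split=> // x ?; apply: DEG; [left|right].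
have Fcover : \forall D \near F,
    [set: Y] `<=` (fun x => exists2 c, D c & ball c e x).
  move/compact_near_coveringP : cY; apply => x _.
  exists (ball x e, [set E | finite_set E /\ [set x] `<=` E]) => /=.
    by split; [exact: nbhsx_ballx|exists [set x]].
  by move=> [y E] /= [xy [_ xE]]; exists x => //; exact: xE.
have Ffin : \forall D \near F, finite_set D by exists set0 => // D [].
have [D [Dcover fD]] := filter_ex (filterI Fcover Ffin).
by exists D => // x; exact: Dcover.
Qed.

Lemma fine_cover_exists {R : realType} {Y : metricType R} (e : R) :
  compact [set: Y] -> 0 < e ->
  exists U : set (set Y), finite_open_cover U /\ (mesh U < e%:E)%E.
Proof.
move=> cY e0.
have e4 : 0 < e / 4 by rewrite divr_gt0.
have e3 : 0 < e / 3 by rewrite divr_gt0.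
have [D fD Dcover] := compact_totally_bounded _ cY e4.
exists [set (ball x (e / 3))^° | x in D]; split.
  split; first exact: finite_image.
  - by move=> _ [x _ <-]; exact: open_interior.
  - apply/seteqP; split=> // x _; have [c Dc cx] := Dcover x.
    exists (ball c (e / 3))^°; first by exists c.
    apply/nbhs_ballP; exists (e / 12) => /=; first by rewrite divr_gt0.
    by move=> y /(ball_triangle cx); apply: le_ball; lra.
apply: (@le_lt_trans _ _ (e / 3 + e / 3)%:E); last by rewrite lte_fin; lra.
apply: mesh_le => _ x y [z _ <-] /interior_subset zx /interior_subset zy.
have := ball_triangle (ball_sym zx) zy; rewrite ballEmdist; exact: ltW.
Qed.

Lemma fine_covers_proper {R : realType} {Y : metricType R} :
  compact [set: Y] -> ProperFilter (@fine_covers R Y).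
Proof.
move=> cY; apply: filter_from_proper; last first.
  by move=> e /(fine_cover_exists _ cY)[U ?]; exists U.
apply: filter_from_filter; first by exists 1 => /=.
move=> d e /= d0 e0; exists (Num.min d e) => /=; first by rewrite lt_min d0.
move=> U [Uc Um]; do 2! split => //; apply: lt_le_trans Um _;
  by rewrite lee_fin ge_min lexx ?orbT.
Qed.

(** If psi oscillates by at most g on the members of U, every V that refines U
    satisfies CP(U) <= CP(V) + g, by [Lambda_word_refine] and [CP_cover_le]; this
    almost monotonicity is what makes the limit in the definition exist. *)
Lemma CP_cvg {R : realType} {Y : metricType R} {p : nat}
    (h : 'I_p -> Y -> Y) (psi : 'I_p -> Y -> R) (A : set Y) :
    compact [set: Y] -> (forall i, continuous (psi i)) ->
  CP_cover h psi A U @[U --> fine_covers] --> CP h psi A.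
Proof.
move=> cY psi_cont; have FF := fine_covers_proper cY.
suff [l cvl] : exists l : \bar R, CP_cover h psi A U @[U --> fine_covers] --> l.
  by rewrite /CP (cvg_lim (@ereal_hausdorff R) cvl).
apply: almost_nondecreasing_is_cvg => g g0.
have osc : \forall U \near fine_covers, forall C, U C -> C !=set0 ->
    forall i x y, C x -> C y -> psi i x <= psi i y + g.
  pose Q C := forall i x y, C x -> C y -> psi i x <= psi i y + g.
  apply: (fine_covers_small Q cY) => [B C QC BC i x y /BC + /BC|x].
    exact: QC.
  have : \forall y \near x, forall i, `|psi i x - psi i y| < g / 2.
    apply: filter_forall => i.
    by have /cvgrPdist_lt := psi_cont i x; apply; rewrite divr_gt0.
  move=> /nbhs_ballP[e e0 eP]; exists e => // i y z /eP/(_ i) + /eP/(_ i).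
  by rewrite !ltr_distlC; lra.
have Ucover : \forall U \near @fine_covers R Y, finite_open_cover U.
  by exists 1 => [|U []]; first exact: ltr01.
near=> U.
have [_ Uo UT] : finite_open_cover U by near: U.
have refine : \forall V \near fine_covers, forall B, V B -> B !=set0 ->
    exists2 C, U C & B `<=` C.
  pose Q B := exists2 C, U C & B `<=` C.
  apply: (fine_covers_small Q cY) => [B C [D UD CD] BC|x].
    by exists D => //; exact: subset_trans CD.
  have [C UC Cx] : (\bigcup_(A in U) A) x by rewrite UT.
  have : nbhs x C by apply: open_nbhs_nbhs; split=> //; exact: Uo.
  by move=> /nbhs_ballP[e e0 eC]; exists e => //; exists C.
apply: filterS refine => V VU.
apply: (@CP_cover_le _ _ _ _ _ _ _ _ _ _ _ _ _ 1) => // n.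
rewrite mul1r /Lambda muleCA lee_wpmul2l ?lee_fin ?invr_ge0 ?exprn_ge0//.
rewrite ge0_sume_distrr => [|w _]; last exact: Lambda_word_ge0.
apply: lee_sum => w _; apply: Lambda_word_refine => // i C x y UC Cx Cy.
by apply: (near osc U _ C) => //; exists x.
Unshelve. all: by end_near. Qed.

(** * Cylinders and compactness of the symbolic space *)

Lemma half_power_lt {R : realType} (e : R) : 0 < e ->
  exists k : nat, 2^-1 ^+ k < e.
Proof.
move=> e0.
have : (fun k => 2^-1 ^+ k : R) @ \oo --> (0 : R).
  by apply: cvg_expr; rewrite ger0_norm ?invr_ge0// invf_lt1// ltr1n.
move=> /cvgr0Pnorm_lt/(_ e e0)[k _ /(_ k (leqnn k))]/=.
by rewrite ger0_norm ?exprn_ge0 ?invr_ge0// => ke; exists k.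
Qed.

Section symbolic.
Context {R : realType} {m : nat}.
Implicit Types a b : symbolic_space R m.

Definition cylinder (k : nat) a : set (symbolic_space R m) :=
  [set b | forall z : int, (absz z <= k)%N -> b z = a z].

(** The symbolic distance is smaller than 2^-k exactly when the first
    disagreement lies outside the window [-k, k]. *)
Lemma cylinder_ball k a : cylinder k a = ball a (2^-1 ^+ k : R).
Proof.
rewrite ballEmdist; apply/seteqP; split => b /=.
- move=> ab; rewrite [mdist _ _]/(symb_dist a b) /symb_dist.
  case: pselect => [h|_]; last by rewrite exprn_gt0 ?invr_gt0.
  case: ex_minnP => j /asboolP[z [<- abz]] _.
  rewrite ltr_iXn2l ?invr_gt0 ?invf_lt1 ?ltr1n//.
  by rewrite ltnNge; apply/negP => /ab/esym.
- rewrite [mdist _ _]/(symb_dist a b) /symb_dist => abk z zk.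
  apply: contrapT => /nesym abz; move: abk; case: pselect => [h|]; last first.
    by move=> + _; apply; exists (absz z); apply/asboolP; exists z.
  case: ex_minnP => j _ /(_ (absz z)) jz.
  rewrite ltr_iXn2l ?invr_gt0 ?invf_lt1 ?ltr1n// ltnNge => /negP; apply.
  by apply: leq_trans zk; apply: jz; apply/asboolP; exists z.
Qed.

Lemma cylinder_eq k a b : cylinder k a b -> cylinder k a = cylinder k b.
Proof.
by move=> ab; apply/seteqP; split => x xc z zk; rewrite xc// ab.
Qed.

Lemma open_cylinder k a : open (cylinder k a).
Proof.
rewrite openE => b /cylinder_eq ->; rewrite cylinder_ball.
by apply: nbhsx_ballx; rewrite exprn_gt0 ?invr_gt0.
Qed.

(** An ultrafilter selects a letter at each position, since there are finitely
    many; it converges to the sequence of selected letters because a ball only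
    constrains a finite window. *)
Lemma symbolic_compact : compact [set: symbolic_space R m].
Proof.
rewrite compact_ultra => F FU _.
have letter z : exists i : 'I_m, F [set a | a z = i].
  apply: contrapT => /forallNP nF.
  have : \forall a \near F, forall i : 'I_m, a z <> i.
    apply: filter_forall => i.
    by have [/nF//|] := in_ultra_setVsetC [set a | a z = i] FU.
  by move=> /filter_ex[a /(_ (a z))].
have [a aP] := boolp.choice letter.
exists a; split=> // B /nbhs_ballP[e /half_power_lt[k ke] aeB].
apply: (@filterS _ F _ (cylinder k a)).
  by rewrite cylinder_ball => b ab; apply/aeB; apply: le_ball ab; exact: ltW.
have : \forall b \near F, forall i : 'I_k.+1,
    b (Posz i) = a (Posz i) /\ b (- Posz i) = a (- Posz i).
  by apply: filter_forall => i; apply: filterI; exact: aP.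
apply: filterS => b ab [n|n] nk.
  by have [] := ab (Ordinal (nk : (n < k.+1)%N)).
by rewrite NegzE; have [] := ab (Ordinal (nk : (n.+1 < k.+1)%N)).
Qed.

End symbolic.

(** * Blocks of a two-sided sequence *)

Section blocks.
Context {R : realType} {m : nat}.
Implicit Types (a : symbolic_space R m) (n k : nat).

(** A word of length n + 2k + 1 on the window [-k, n + k], stored as the part
    read on [0, n), followed by the parts on [-k, 0) and on [n, n + k].  The
    first component is the word along which the semigroup acts. *)
Definition block n k : Type :=
  (n.-tuple 'I_m * (k.-tuple 'I_m * k.+1.-tuple 'I_m))%type.

Definition block_of n k a : block n k :=
  ([tuple a (Posz i) | i < n],
    ([tuple a (Negz i) | i < k], [tuple a (Posz (n + i)) | i < k.+1])).

Lemma iter_shift (j : nat) a (z : int) : iter j Defs.shift a z = a (z + Posz j).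
Proof.
elim: j z => [|j IH] z /=; first by rewrite addr0.
by rewrite /Defs.shift IH; congr (a _); lia.
Qed.

Lemma block_of_surj n k (t : block n k) : exists a, block_of n k a = t.
Proof.
case: t => w [l r].
exists (fun z => match z with
  | Posz i => nth (thead r) (w ++ r) i
  | Negz i => nth (thead r) l i end).
congr (_, (_, _)); apply: eq_from_tnth => i; rewrite tnth_mktuple.
- by rewrite nth_cat size_tuple ltn_ord -tnth_nth.
- by rewrite -tnth_nth.
- by rewrite nth_cat size_tuple ltnNge leq_addr/= addKn -tnth_nth.
Qed.

(** The windows [j - k, j + k] for 0 <= j <= n cover exactly [-k, n + k]. *)
Lemma block_ofP n k a a' :
  (forall j : 'I_n.+1,
    cylinder k (iter j Defs.shift a') (iter j Defs.shift a)) <->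
  block_of n k a = block_of n k a'.
Proof.
split=> [aa'|].
  congr (_, (_, _)); apply: eq_from_tnth => i; rewrite !tnth_mktuple.
  - have := aa' (widen_ord (leqnSn n) i) 0 (leq0n k).
    by rewrite !iter_shift !add0r.
  - have := aa' ord0 (Negz i) (ltn_ord i : (absz (Negz i) <= k)%N).
    by rewrite !iter_shift !addr0.
  - have := aa' ord_max (Posz i) (ltn_ord i : (absz (Posz i) <= k)%N).
    by rewrite !iter_shift -PoszD addnC.
move=> aa' j z zk; rewrite !iter_shift.
have jn : (j <= n)%N by rewrite -ltnS.
have : (absz (z + Posz j)%R <= n + k)%N by lia.
case E : (z + Posz j) => [l|l] /= lnk.
- have [ln|nl] := ltnP l n.
    have /(congr1 (fun t => tnth t.1 (Ordinal ln))) := aa'.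
    by rewrite !tnth_mktuple.
  have lk : (l - n < k.+1)%N by lia.
  have /(congr1 (fun t => tnth t.2.2 (Ordinal lk))) := aa'.
  by rewrite !tnth_mktuple/= subnKC.
- have lk : (l < k)%N by lia.
  have /(congr1 (fun t => tnth t.2.1 (Ordinal lk))) := aa'.
  by rewrite !tnth_mktuple.
Qed.

End blocks.

(** * Product covers and the skew product *)

Definition product_cover {R : realType} {m : nat} {X : metricType R} (k : nat)
    (U : set (set X)) : set (set (symbolic_space R m * X)) :=
  [set cylinder k a `*` B | a in [set: symbolic_space R m] & B in U].

(** The strings of product sets with a nonempty string set all have this form:
    their cylinders are the successive windows of a single sequence. *)
Definition product_string {R : realType} {m : nat} {X : metricType R}
    (k : nat) (a : symbolic_space R m) {n : nat} (u : n.+1.-tuple (set X)) :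
    n.+1.-tuple (set (symbolic_space R m * X)) :=
  [tuple cylinder k (iter j Defs.shift a) `*` tnth u j | j < n.+1].

(** A cylinder over [-k, k] is a block with n = 0. *)
Lemma finite_cylinders {R : realType} {m : nat} (k : nat) :
  finite_set [set cylinder k a | a in [set: symbolic_space R m]].
Proof.
have [r rP] := boolp.choice (@block_of_surj R m 0 k).
apply: (@sub_finite_set _ _ [set cylinder k (r t) | t in setT]).
  move=> _ [a _ <-]; exists (block_of 0 k a) => //.
  by apply: cylinder_eq; have /block_ofP/(_ ord0) := esym (rP (block_of 0 k a)).
by apply: finite_image; exact: finite_finset.
Qed.

Lemma product_cover_finite_open {R : realType} {m : nat} {X : metricType R}
    (k : nat) (U : set (set X)) : finite_open_cover U ->
  finite_open_cover (product_cover (m := m) k U).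
Proof.
move=> [Ufin Uo UT]; split.
- apply: sub_finite_set (finite_image2 (fun C B => C `*` B)
    (finite_cylinders (R := R) (m := m) k) Ufin).
  by move=> _ [a _ [B UB <-]]; exists (cylinder k a); [exists a|exists B].
- move=> _ [a _ [B UB <-]]; rewrite openE => -[a' x] [/= aa' Bx].
  exists (cylinder k a, B) => //=; split.
    by apply: open_nbhs_nbhs; split => //; exact: open_cylinder.
  by apply: open_nbhs_nbhs; split => //; exact: Uo.
- apply/seteqP; split=> // -[a x] _.
  have [B UB Bx] : (\bigcup_(A in U) A) x by rewrite UT.
  by exists (cylinder k a `*` B) => //; exists a => //; exists B.
Qed.

(** The bound on the cylinders uses that every point of one is its centre. *)
Lemma mesh_product_cover {R : realType} {m : nat} {X : metricType R}
    (k : nat) (U : set (set X)) (e : R) : 2^-1 ^+ k <= e -> (mesh U < e%:E)%E ->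
  (mesh (product_cover (m := m) k U) <= e%:E)%E.
Proof.
move=> ke Ue; apply: mesh_le => _ [a1 x1] [a2 x2] [a _ [B UB <-]].
move=> [/= c1 Bx1] [/= c2 Bx2].
rewrite [mdist _ _]/(prod_mdist (a1, x1) (a2, x2)) /prod_mdist ge_max /=.
apply/andP; split; apply: ltW; last first.
  by have := mesh_lt_ball U e Ue B x1 x2 UB Bx1 Bx2; rewrite ballEmdist.
apply: lt_le_trans ke.
suff : ball a1 (2^-1 ^+ k : R) a2 by rewrite ballEmdist.
by rewrite -cylinder_ball -(cylinder_eq _ _ _ c1).
Qed.

Section skew.
Context {R : realType} {X : metricType R} {m : nat}.
Variables (f : 'I_m -> X -> X) (phi : X -> R) (c : R).

Local Notation F := (fun _ : 'I_1 => @skew_product R m X f).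
Local Notation g :=
  (fun (_ : 'I_1) (z : symbolic_space R m * X) => c + phi z.2).

Lemma word_orbit_skew n k (w1 : n.-tuple 'I_1) j (a : symbolic_space R m) x :
  (j <= n)%N -> word_orbit F w1 j (a, x) =
    (iter j Defs.shift a, word_orbit f (block_of n k a).1 j x).
Proof.
rewrite /word_orbit; elim: j => [|j IH] jn; first by rewrite !take0.
rewrite (@take_nth _ (ord0 : 'I_1) j w1) ?size_tuple// foldl_rcons.
rewrite (IH (ltnW jn)).
set w := (block_of n k a).1.
rewrite (take_nth (tnth w (Ordinal jn))) ?size_tuple// foldl_rcons.
rewrite -(tnth_nth _ w (Ordinal jn)) tnth_mktuple.
by congr (_, _); rewrite /= iter_shift add0r.
Qed.

Lemma word_sum_skew n k (w1 : n.-tuple 'I_1) (a : symbolic_space R m) x :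
  word_sum F g w1 (a, x) =
  c * n%:R + word_sum f (fun=> phi) (block_of n k a).1 x.
Proof.
rewrite /word_sum mulr_natr -[n in _ *+ n]card_ord -sumr_const -big_split/=.
by apply: eq_bigr => j _; rewrite (word_orbit_skew _ k)// ltnW.
Qed.

(** The string set of a product string splits as a cylinder over [-k, n + k]
    times a string set of the semigroup. *)
Lemma string_set_skew n k (w1 : n.-tuple 'I_1) (a a' : symbolic_space R m)
    (u : n.+1.-tuple (set X)) x :
  string_set F w1 (product_string k a u) (a', x) <->
  block_of n k a' = block_of n k a /\ string_set f (block_of n k a).1 u x.
Proof.
have orb (j : 'I_n.+1) := word_orbit_skew n k w1 j a' x (ltn_ord j).
split=> [ax|[a'a ux] j]; last first.
  rewrite tnth_mktuple orb; split; last by rewrite a'a.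
  exact: (iffRL (block_ofP n k a' a) a'a).
have a'a : block_of n k a' = block_of n k a.
  by apply/block_ofP => j; have := ax j; rewrite tnth_mktuple orb => -[].
split=> // j; have := ax j; rewrite tnth_mktuple orb => -[_].
by rewrite a'a.
Qed.

Lemma sup_exp_skew_le n k (w1 : n.-tuple 'I_1) (a : symbolic_space R m)
    (u : n.+1.-tuple (set X)) :
  (sup_exp (word_sum F g w1) (string_set F w1 (product_string k a u)) <=
   (expR (c * n%:R))%:E * sup_exp (word_sum f (fun=> phi) (block_of n k a).1)
                            (string_set f (block_of n k a).1 u))%E.
Proof.
apply: le_sup_exp => -[a' x] /string_set_skew[a'a ux]; exists x => //.
by rewrite (word_sum_skew _ k) a'a addrC.
Qed.

Lemma sup_exp_skew_ge n k (w1 : n.-tuple 'I_1) (a : symbolic_space R m)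
    (u : n.+1.-tuple (set X)) :
  (sup_exp (word_sum f (fun=> phi) (block_of n k a).1)
     (string_set f (block_of n k a).1 u) <=
   (expR (- (c * n%:R)))%:E *
   sup_exp (word_sum F g w1) (string_set F w1 (product_string k a u)))%E.
Proof.
apply: le_sup_exp => x ux; exists (a, x); first exact/string_set_skew.
by rewrite (word_sum_skew _ k) [X in X - _]addrC addrK.
Qed.

End skew.

(** The cylinders being nonempty, the X-parts can be recovered by projecting, so
    distinct X-strings give distinct product strings. *)
Lemma product_stringK {R : realType} {m : nat} {X : metricType R} (k : nat)
    (a : symbolic_space R m) {n : nat} (u : n.+1.-tuple (set X)) :
  map_tuple (fun B => snd @` B) (product_string k a u) = u.
Proof.
apply: eq_from_tnth => j; rewrite tnth_map tnth_mktuple.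
apply/seteqP; split=> [_ [[b x] [_ /= ux] <-]//|x ux].
by exists (iter j Defs.shift a, x).
Qed.

Section skew_lambda.
Context {R : realType} {X : metricType R} {m : nat}.
Variables (f : 'I_m -> X -> X) (phi : X -> R) (c : R) (Z : set X).

Local Notation F := (fun _ : 'I_1 => @skew_product R m X f).
Local Notation g :=
  (fun (_ : 'I_1) (z : symbolic_space R m * X) => c + phi z.2).
Local Notation SZ := ([set: symbolic_space R m] `*` Z).

(** The number m ^ (2k + 1) of blocks that extend a given word of length n. *)
Definition flank_count (k : nat) : nat :=
  #|{: k.-tuple 'I_m * k.+1.-tuple 'I_m}|.

Lemma sum_block n k (L : n.-tuple 'I_m -> \bar R) : (forall w, 0 <= L w)%E ->
  (\sum_(t : @block m n k) L t.1 =
   (flank_count k)%:R%:E * \sum_(w : n.-tuple 'I_m) L w)%E.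
Proof.
move=> L0; rewrite ge0_sume_distrr => [|w _]; last exact: L0.
transitivity (\sum_(w : n.-tuple 'I_m)
    \sum_(s : k.-tuple 'I_m * k.+1.-tuple 'I_m) L w)%E.
  by rewrite pair_bigA.
by apply: eq_bigr => w _; rewrite /= sumr_const mule_natl.
Qed.

(** Near-optimal families for the words t.1, chosen independently for each block
    t, assemble into one family of product strings. *)
Lemma Lambda_word_skew_le n k (w1 : n.-tuple 'I_1) (U : set (set X)) :
  (Lambda_word F g SZ (product_cover k U) w1 <=
   (flank_count k)%:R%:E * ((expR (c * n%:R))%:E *
     \sum_(w : n.-tuple 'I_m) Lambda_word f (fun=> phi) Z U w))%E.
Proof.
rewrite muleCA -lee_pdivrMl ?expR_gt0//.
rewrite -(sum_block n k) => [|w]; last exact: Lambda_word_ge0.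
apply: le_sum_ereal_inf => [t _ [G _ <-]|s sG].
  by apply: esum_ge0 => u _; exact: expeR_ge0.
rewrite lee_pdivrMl ?expR_gt0//.
have {}sG (t : block n k) : exists G : set (n.+1.-tuple (set X)),
    string_cover f Z U t.1 G /\ (\esum_(u in G)
      sup_exp (word_sum f (fun=> phi) t.1) (string_set f t.1 u))%E = s t.
  by have [G] := sG t; exists G.
have [G GP] := boolp.choice sG.
have [r rP] := boolp.choice (@block_of_surj R m n k).
pose P := [set: block n k] `*`` G.
pose e (tu : block n k * n.+1.-tuple (set X)) :=
  product_string k (r tu.1) tu.2.
have eP : string_cover F SZ (product_cover k U) w1 (e @` P).
  split.
  - apply: (@sub_countable _ _ _ (\bigcup_(t in [set: block n k])
        (fun u => e (t, u)) @` G t)).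
      apply: subset_card_le => _ [[t u] [_ /= Gu] <-].
      by exists t => //; exists u.
    apply: bigcup_countable => [|t _]; first exact: countableP.
    have [[cG _ _] _] := GP t.
    exact: card_le_trans (card_image_le _ _) cG.
  - move=> _ [[t u] [_ /= Gu] <-] j; rewrite tnth_mktuple.
    have [[_ GU _] _] := GP t.
    exists (iter j Defs.shift (r t)) => //; exists (tnth u j) => //.
    exact: (GU u Gu j).
  - move=> [a x] [_ /= Zx]; pose t := block_of n k a.
    have [[_ _ ZG] _] := GP t.
    have [u Gu ux] := ZG x Zx.
    exists (e (t, u)); first by exists (t, u).
    by apply/string_set_skew; rewrite rP; split.
apply: le_trans (ereal_inf_lbound _) _; first by exists (e @` P); [exact: eP|].
apply: le_trans (esum_image_le _ _ _ _) _; first by move=> ?; exact: expeR_ge0.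
pose wt (t : block n k) (u : n.+1.-tuple (set X)) :=
  sup_exp (word_sum f (fun=> phi) t.1) (string_set f t.1 u).
apply: (@le_trans _ _ ((expR (c * n%:R))%:E * \esum_(tu in P) wt tu.1 tu.2)%E).
  apply: esum_le_scale => [|tu|tu _]; [exact: expR_ge0|exact: sup_exp_ge0|].
  by rewrite /wt -(rP tu.1); exact: sup_exp_skew_le.
rewrite lee_wpmul2l ?lee_fin ?expR_ge0//.
rewrite -(@esum_esum _ _ _ setT G wt) => [|t u _ _]; last exact: sup_exp_ge0.
rewrite esum_fintype => [|t]; last first.
  by apply: esum_ge0 => u _; exact: sup_exp_ge0.
by apply: lee_sum => t _; have [_ <-] := GP t.
Qed.

(** A family for the skew product contains, for each block t, a family for the
    word t.1: its product strings with the cylinders of t.  These subfamilies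
    are disjoint, so their costs add up to at most the cost of the whole. *)
Lemma Lambda_word_skew_ge n k (w1 : n.-tuple 'I_1) (U : set (set X)) :
  ((flank_count k)%:R%:E * ((expR (c * n%:R))%:E *
     \sum_(w : n.-tuple 'I_m) Lambda_word f (fun=> phi) Z U w) <=
   Lambda_word F g SZ (product_cover k U) w1)%E.
Proof.
rewrite muleCA -(sum_block n k) => [|w]; last exact: Lambda_word_ge0.
apply: le_ereal_inf_tmp => _ [G [cG GV SG] <-].
rewrite -lee_pdivlMl ?expR_gt0// -expRN.
have [r rP] := boolp.choice (@block_of_surj R m n k).
pose e (tu : block n k * n.+1.-tuple (set X)) :=
  product_string k (r tu.1) tu.2.
(* The subfamily attached to t.  Nonemptiness is needed for disjointness: a
   product string with an empty factor does not determine its cylinders. *)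
pose Gt (t : block n k) := [set u : n.+1.-tuple (set X) |
  [/\ forall j, U (tnth u j), G (e (t, u))
    & string_set F w1 (e (t, u)) !=set0]].
pose P := [set: block n k] `*`` Gt.
have e_inj : set_inj P e.
  move=> [t u] [t' u'] /[!inE] -[_ /= [_ _ [[a x] ax]]] _ e_eq.
  have /string_set_skew[at_ _] := ax.
  have := ax; rewrite e_eq => /string_set_skew[at'_ _].
  congr (_, _); first by rewrite -[t]rP -[t']rP -at_ -at'_.
  rewrite -(product_stringK k (r t) u) -[RHS](product_stringK k (r t') u').
  by rewrite -[product_string k (r t) u]/(e (t, u)) e_eq.
have GtP t : string_cover f Z U t.1 (Gt t).
  split.
  - apply: (@sub_countable _ _ _ (map_tuple (fun B => snd @` B) @` G)).
      apply: subset_card_le => u [_ Geu _]; exists (e (t, u)) => //.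
      exact: product_stringK.
    exact: card_le_trans (card_image_le _ _) cG.
  - by move=> u [].
  - move=> x Zx.
    (* A string through (r t, x) is a product string for t: its j-th cylinder
       contains the j-th shift of r t, hence is centred there. *)
    have [s Gs sx] := SG (r t, x) (conj I Zx).
    have sP j : exists B,
        U B /\ tnth s j = cylinder k (iter j Defs.shift (r t)) `*` B.
      have [a _ [B UB saB]] := GV s Gs j; exists B; split=> //.
      have := sx j; rewrite -saB (word_orbit_skew _ _ k) => [[/= ca _]|];
          last first.
        by rewrite -ltnS.
      by rewrite (cylinder_eq _ _ _ ca).
    have [B BP] := boolp.choice sP.
    pose u := [tuple B j | j < n.+1].
    have se : s = e (t, u).
      by apply: eq_from_tnth => j; rewrite !tnth_mktuple; exact: (BP j).2.
    rewrite se in Gs sx.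
    exists u; last by move: sx => /string_set_skew[_]; rewrite rP.
    split=> //; last by exists (r t, x).
    by move=> j; rewrite tnth_mktuple; exact: (BP j).1.
pose skew_wt s := sup_exp (word_sum F g w1) (string_set F w1 s).
apply: (@le_trans _ _
    ((expR (- (c * n%:R)))%:E * \esum_(s in e @` P) skew_wt s)%E); last first.
  rewrite lee_wpmul2l ?lee_fin ?expR_ge0//; apply: esum_subset => [s|].
    exact: sup_exp_ge0.
  by move=> _ [[t u] [_ [_ Geu _]] <-].
rewrite esum_image//.
pose wt (t : block n k) (u : n.+1.-tuple (set X)) :=
  sup_exp (word_sum f (fun=> phi) t.1) (string_set f t.1 u).
apply: (@le_trans _ _ (\esum_(tu in P) wt tu.1 tu.2)%E); last first.
  apply: esum_le_scale => [|tu|tu _]; [exact: expR_ge0|exact: sup_exp_ge0|].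
  by rewrite /wt -(rP tu.1); exact: sup_exp_skew_ge.
rewrite -(@esum_esum _ _ _ setT Gt wt) => [|t u _ _]; last exact: sup_exp_ge0.
rewrite esum_fintype => [|t]; last first.
  by apply: esum_ge0 => u _; exact: sup_exp_ge0.
by apply: lee_sum => t _; apply: ereal_inf_lbound; exists (Gt t).
Qed.

End skew_lambda.

Section skew_pressure.
Context {R : realType} {X : metricType R} {m : nat}.
Variables (f : 'I_m -> X -> X) (phi : X -> R) (c : R) (Z : set X).

Local Notation F := (fun _ : 'I_1 => @skew_product R m X f).
Local Notation g :=
  (fun (_ : 'I_1) (z : symbolic_space R m * X) => c + phi z.2).
Local Notation SZ := ([set: symbolic_space R m] `*` Z).

(** The factor m ^ n turns the sum over the words into the average used in
    [Lambda] for the semigroup; for a single map the average is trivial. *)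
Lemma Lambda_skew n k (U : set (set X)) : (0 < m)%N ->
  (Lambda F g SZ (product_cover k U) n =
   ((flank_count (m := m) k)%:R * expR ((ln m%:R + c) * n%:R))%:E *
     Lambda f (fun=> phi) Z U n)%E.
Proof.
move=> m_gt0; rewrite /Lambda expr1n invr1 mul1e.
rewrite (big_pred1 [tuple ord0 | _ < n]); last first.
  move=> w; apply/esym/eqP/eq_from_tnth => i.
  by rewrite tnth_mktuple; exact: ord1.
have -> : Lambda_word F g SZ (product_cover k U) [tuple ord0 | _ < n] =
   ((flank_count (m := m) k)%:R%:E * ((expR (c * n%:R))%:E *
     \sum_(w : n.-tuple 'I_m) Lambda_word f (fun=> phi) Z U w))%E.
  by apply/eqP; rewrite eq_le Lambda_word_skew_le Lambda_word_skew_ge.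
rewrite !muleA -!EFinM; congr (_%:E * _)%E.
rewrite -!mulrA; congr (_ * _); rewrite mulrDl expRD [ln _ * _]mulrC expRM_natl.
rewrite lnK ?posrE ?ltr0n// mulrAC mulfV ?mul1r//.
by rewrite expf_neq0 ?pnatr_eq0 -?lt0n.
Qed.

Lemma CP_cover_skew k (U : set (set X)) : (0 < m)%N ->
  (CP_cover F g SZ (product_cover k U) =
   CP_cover f (fun=> phi) Z U + (ln m%:R + c)%:E)%E.
Proof.
move=> m_gt0; have K0 : (0 < (flank_count (m := m) k)%:R :> R).
  rewrite ltr0n /flank_count card_prod !card_tuple card_ord muln_gt0.
  by rewrite !expn_gt0 m_gt0.
apply/eqP; rewrite eq_le; apply/andP; split.
  by apply: (@CP_cover_le _ _ _ _ _ _ _ _ _ _ _ _ _ _ _ (ltW K0)) => n;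
    rewrite Lambda_skew//.
rewrite -leeBrDr// -EFinN.
apply: (@CP_cover_le _ _ _ _ _ _ _ _ _ _ _ _ _
    (flank_count (m := m) k)%:R^-1).
  by rewrite invr_ge0 ltW.
move=> n; rewrite Lambda_skew// muleA -EFinM mulrACA mulVf ?gt_eqF// mul1r.
by rewrite -expRD mulNr addNr expR0 mul1e.
Qed.

End skew_pressure.

(** * The pressure of the skew product *)

(** Limits over all fine covers can be evaluated along any sequence of covers of
    vanishing mesh. *)
Lemma cvg_fine_covers {R : realType} {Y : metricType R}
    (W : nat -> set (set Y)) :
    (forall k, finite_open_cover (W k)) ->
    (forall k, mesh (W k) <= (2^-1 ^+ k : R)%:E)%E ->
  W @ \oo --> @fine_covers R Y.
Proof.
move=> Wo Wm Q [e /= /half_power_lt[k0 k0e] eQ]; exists k0 => // k /= k0k.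
apply: eQ; split => //; apply: le_lt_trans (Wm k) _; rewrite lte_fin.
by apply: le_lt_trans k0e; rewrite ler_wiXn2l ?invr_ge0 ?invf_le1 ?ler1n.
Qed.

Theorem theorem2p3 (R : realType) (X : metricType R) (m : nat)
    (f : 'I_m -> X -> X) (phi : X -> R) (c : R) (Z : set X)
    (m_gt0 : (0 < m)%N) (X_compact : compact [set: X])
    (f_cont : forall i, continuous (f i)) (phi_cont : continuous phi) :
  CP (fun _ : 'I_1 => @skew_product R m X f)
     (fun (_ : 'I_1) (z : symbolic_space R m * X) => c + phi z.2)
     ([set: symbolic_space R m] `*` Z)
  = ((ln m%:R)%:E + CP f (fun _ : 'I_m => phi) Z + c%:E)%E.
Proof.
have SX_compact : compact [set: symbolic_space R m * X].
  by rewrite -setXTT; apply: compact_setX => //; exact: symbolic_compact.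
have fine k : exists U : set (set X),
    finite_open_cover U /\ (mesh U < (2^-1 ^+ k)%:E)%E.
  by apply: fine_cover_exists => //; rewrite exprn_gt0 ?invr_gt0.
have [U UP] := boolp.choice fine.
pose V k := product_cover (m := m) k (U k).
have U_fine : U @ \oo --> @fine_covers R X.
  by apply: cvg_fine_covers => k; [exact: (UP k).1|exact: ltW (UP k).2].
have V_fine : V @ \oo --> @fine_covers R (symbolic_space R m * X)%type.
  apply: cvg_fine_covers => k; first exact: product_cover_finite_open (UP k).1.
  by apply: mesh_product_cover (UP k).2.
have cvgX := cvg_comp _ _ U_fine
  (CP_cvg f (fun=> phi) Z X_compact (fun=> phi_cont)).
have g_cont : continuous (fun z : symbolic_space R m * X => c + phi z.2).
  move=> z; apply: cvgD; first exact: cvg_cst.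
  by apply: continuous_comp; [exact: cvg_snd|exact: phi_cont].
have cvgF := cvg_comp _ _ V_fine
  (CP_cvg (fun _ : 'I_1 => @skew_product R m X f) _ ([set: _] `*` Z) SX_compact
    (fun=> g_cont)).
have cvgG :
    (CP_cover f (fun=> phi) Z (U k) + (ln m%:R + c)%:E)%E @[k --> \oo] -->
    (CP f (fun=> phi) Z + (ln m%:R + c)%:E)%E.
  by apply: cvgeD cvgX (cvg_cst _); rewrite fin_num_adde_defl.
rewrite addeAC -EFinD addeC; apply: (cvg_unique (@ereal_hausdorff R) cvgF).
apply: cvg_trans cvgG; apply: near_eq_cvg; apply: nearW => k.
by rewrite /= CP_cover_skew.
Qed.
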